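(* Let $\mathbb{F}\in\{\mathbb{R},\mathbb{C}\}$, $q\ge2$, and let $\mathscr{O}=\{O_i\}_{i=1}^n$ be self-adjoint $q\times q$ matrices over $\mathbb{F}$, where $O_i$ has $q_i\ge2$ distinct eigenvalues. The trace of the Gram superoperator is $$\mathrm{Tr}\Big[\tfrac1n\mathfrak{D}^*\mathfrak{D}\Big]=\bar q:=\frac1n\sum_{i=1}^nq_i.$$ Consequently, the smallest eigenvalue $\tau_{\min}$ of the Gram superoperator on $\mathbb{F}^{q\times q}_{sa}$ satisfies $$\tau_{\min}\le\alpha:=\frac{\bar q-1}{q-1}\cdot\alpha_{\mathcal{Q}},\qquad\alpha_{\mathcal{Q}}=\begin{cases}(q/2+1)^{-1}&\mathbb{F}=\mathbb{R},\\(q+1)^{-1}&\mathbb{F}=\mathbb{C},\end{cases}$$ with equality if and only if $\mathscr{O}$ is an $\alpha$-unitary design.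
   Context: $\mathbb{F}^{q\times q}_{sa}$ is the real vector space of self-adjoint (symmetric if $\mathbb{F}=\mathbb{R}$, Hermitian if $\mathbb{F}=\mathbb{C}$) $q\times q$ matrices with Frobenius inner product $\langle A,B\rangle_2=\mathrm{Tr}[AB]$. Each $O_i=\sum_{k=1}^{q_i}\lambda_{ik}\Pi_{ik}$ with distinct eigenvalues, orthogonal eigenprojections $\Pi_{ik}$ and multiplicities $m_{ik}=\mathrm{Tr}[\Pi_{ik}]$. The Gram superoperator is the self-adjoint linear map $\frac1n\mathfrak{D}^*\mathfrak{D}:\mathbb{F}^{q\times q}_{sa}\to\mathbb{F}^{q\times q}_{sa}$, $S\mapsto\frac1n\sum_{i=1}^n\sum_{k=1}^{q_i}\frac{\mathrm{Tr}[S\Pi_{ik}]}{m_{ik}}\Pi_{ik}$; its trace is the trace as a linear map on the real vector space $\mathbb{F}^{q\times q}_{sa}$. The collection is an $\alpha$-unitary design if $\frac1n\mathfrak{D}^*\mathfrak{D}\,\Delta=\alpha\Delta$ for every traceless $\Delta\in\mathbb{F}^{q\times q}_{sa}$. *)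

(* Defs.v *)
From HB Require Import structures.
From mathcomp Require Import all_boot all_order all_algebra.
From mathcomp Require Import complex polyrcf.
From mathcomp Require Import reals.

Set Implicit Arguments.
Unset Strict Implicit.
Unset Printing Implicit Defensive.

Import Order.TTheory GRing.Theory Num.Theory.
Import passmx.

Local Open Scope ring_scope.

Definition lftrace (K : fieldType) (vT : vectType K) (f : 'End(vT)) : K :=
  \tr (mxof (vbasis {:vT}) (vbasis {:vT}) f).

Definition is_smallest_eigenvalue (K : numFieldType) (vT : vectType K)
    (f : 'End(vT)) (a : K) : Prop :=
  leigenvalue f a /\ forall b, leigenvalue f b -> a <= b.

Variant field_kind := RealField | ComplexField.

Definition scalars (R : rcfType) (F : field_kind) : numFieldType :=
  match F with RealField => R | ComplexField => R[i] end.

Section Scalars.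
Variables (R : rcfType) (F : field_kind).

Definition sconj : scalars R F -> scalars R F :=
  match F with RealField => fun x => x | ComplexField => fun x => conjc x end.

Definition of_real : R -> scalars R F :=
  match F with RealField => fun x => x | ComplexField => fun x => x%:C%C end.

Fact sconj_is_zmod_morphism : zmod_morphism sconj.
Proof. by rewrite /sconj; case: F => // x y; exact: rmorphB. Qed.
Fact sconj_is_monoid_morphism : monoid_morphism sconj.
Proof.
by rewrite /sconj; case: F => //; split; [exact: rmorph1|exact: rmorphM].
Qed.
HB.instance Definition _ := GRing.isZmodMorphism.Build _ _ sconj
  sconj_is_zmod_morphism.
HB.instance Definition _ := GRing.isMonoidMorphism.Build _ _ sconj
  sconj_is_monoid_morphism.

Fact of_real_is_zmod_morphism : zmod_morphism of_real.
Proof. by rewrite /of_real; case: F => // x y; exact: rmorphB. Qed.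
Fact of_real_is_monoid_morphism : monoid_morphism of_real.
Proof.
by rewrite /of_real; case: F => //; split; [exact: rmorph1|exact: rmorphM].
Qed.
HB.instance Definition _ := GRing.isZmodMorphism.Build _ _ of_real
  of_real_is_zmod_morphism.
HB.instance Definition _ := GRing.isMonoidMorphism.Build _ _ of_real
  of_real_is_monoid_morphism.

Lemma sconjK : involutive sconj.
Proof. by rewrite /sconj; case: F => //; exact: conjcK. Qed.

Lemma sconj_of_real a : sconj (of_real a) = of_real a.
Proof. by rewrite /sconj /of_real; case: F => //; exact: conjc_real. Qed.

Lemma mul_sconj_ge0 (x : scalars R F) : 0 <= x * sconj x.
Proof.
rewrite /sconj; move: x; rewrite /scalars; case: F => /= x.
  by rewrite -expr2 sqr_ge0.
exact: mul_conjC_ge0.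
Qed.

(* An alias of 'M_q carrying the R-module structure by restriction of scalars. *)
Definition realified (q : nat) : Type := 'M[scalars R F]_q.
HB.instance Definition _ q := GRing.Zmodule.on (realified q).

Section Realified.
Variable q : nat.

Definition rscale (a : R) (A : realified q) : realified q :=
  of_real a *: (A : 'M_q).

Fact rscaleA a b A : rscale a (rscale b A) = rscale (a * b) A.
Proof. by rewrite /rscale scalerA rmorphM. Qed.
Fact rscale1 : left_id 1 rscale.
Proof. by move=> A; rewrite /rscale rmorph1 scale1r. Qed.
Fact rscaleDr : right_distributive rscale +%R.
Proof. by move=> a A B; rewrite /rscale scalerDr. Qed.
Fact rscaleDl A : {morph rscale^~ A : a b / a + b}.
Proof. by move=> a b; rewrite /rscale rmorphD scalerDl. Qed.

HB.instance Definition _ := GRing.Zmodule_isLmodule.Build R (realified q)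
  rscaleA rscale1 rscaleDr rscaleDl.

Lemma rscaleE a (A : realified q) : a *: A = of_real a *: (A : 'M_q).
Proof. by []. Qed.
End Realified.
End Scalars.

Fact realified_vect_iso (R : rcfType) F q :
  Vector.axiom (if F is RealField then q * q else q * q + q * q)%N
    (realified R F q).
Proof.
case: F.
  exists (fun A : 'M[R]_q => mxvec A); first by move=> a A B; exact: linearP.
  by exists vec_mx; [exact: mxvecK|exact: vec_mxK].
exists (fun A : 'M[R[i]]_q => row_mx (mxvec (map_mx (@complex.Re R) A))
                                    (mxvec (map_mx (@complex.Im R) A))).
  move=> a A B; rewrite scale_row_mx add_row_mx -!linearP.
  congr (row_mx (mxvec _) (mxvec _)); apply/matrixP=> i j; rewrite !mxE.
    by case: (A i j) (B i j) => [x y] [z t] /=; rewrite mul0r subr0.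
  by case: (A i j) (B i j) => [x y] [z t] /=; rewrite mul0r addr0.
exists (fun v : 'rV[R]_(q * q + q * q) =>
  \matrix_(i, j) Complex (vec_mx (lsubmx v) i j) (vec_mx (rsubmx v) i j)).
  move=> A; apply/matrixP=> i j; rewrite mxE row_mxKl row_mxKr !mxvecK !mxE.
  by case: (A i j).
move=> v; rewrite -[RHS]hsubmxK; congr row_mx.
  by rewrite -[RHS]vec_mxK; congr mxvec; apply/matrixP=> i j; rewrite !mxE.
by rewrite -[RHS]vec_mxK; congr mxvec; apply/matrixP=> i j; rewrite !mxE.
Qed.
HB.instance Definition _ (R : rcfType) F q :=
  Lmodule_hasFinDim.Build R (realified R F q) (realified_vect_iso R F q).

Definition adjmx (R : rcfType) F m n (A : 'M[scalars R F]_(m, n)) :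
  'M[scalars R F]_(n, m) := map_mx (@sconj R F) A^T.

Section SelfAdjoint.
Variables (R : rcfType) (F : field_kind).
Local Notation K := (scalars R F).

Lemma adjmxK m n : cancel (@adjmx R F m n) (@adjmx R F n m).
Proof. by move=> A; apply/matrixP=> i j; rewrite !mxE sconjK. Qed.
Lemma adjmxD m n : {morph @adjmx R F m n : A B / A + B}.
Proof. by move=> A B; rewrite /adjmx linearD /= map_mxD. Qed.
Lemma adjmxB m n : {morph @adjmx R F m n : A B / A - B}.
Proof. by move=> A B; rewrite /adjmx linearB /= map_mxB. Qed.
Lemma adjmxZ m n a (A : 'M[K]_(m, n)) : adjmx (a *: A) = sconj a *: adjmx A.
Proof. by rewrite /adjmx linearZ /= map_mxZ. Qed.
Lemma adjmxM m n p (A : 'M[K]_(m, n)) (B : 'M_(n, p)) :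
  adjmx (A *m B) = adjmx B *m adjmx A.
Proof. by rewrite /adjmx trmx_mul map_mxM. Qed.
Lemma adjmx1 n : adjmx 1%:M = 1%:M :> 'M[K]_n.
Proof. by rewrite /adjmx trmx1 map_mx1. Qed.
Lemma mxtrace_adj n (A : 'M[K]_n) : \tr (adjmx A) = sconj (\tr A).
Proof. by rewrite /adjmx trace_map_mx mxtrace_tr. Qed.

Variable q : nat.

Definition adj_defect (A : realified R F q) : realified R F q := adjmx A - A.

Fact adj_defect_linear : linear adj_defect.
Proof.
move=> a A B; rewrite /adj_defect !rscaleE adjmxD adjmxZ sconj_of_real.
by rewrite opprD addrACA -scalerBr.
Qed.
HB.instance Definition _ := GRing.isLinear.Build R _ _ _ adj_defect
  adj_defect_linear.

Definition selfadjoint : {vspace realified R F q} :=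
  lker (linfun adj_defect).

Lemma mem_selfadjoint (A : realified R F q) :
  (A \in selfadjoint) = (adjmx A == A).
Proof. by rewrite memv_ker lfunE /= subr_eq0. Qed.

Definition samx := subvs_of selfadjoint.

Definition mx_of_sa (A : samx) : 'M[K]_q := vsval A.

Lemma mx_of_saP (A : samx) : adjmx (mx_of_sa A) = mx_of_sa A.
Proof. by apply/eqP; rewrite -mem_selfadjoint; exact: subvsP. Qed.

End SelfAdjoint.

HB.instance Definition _ R F q := Vector.on (samx R F q).
Coercion mx_of_sa : samx >-> matrix.

(* Only meaningful for a nonzero polynomial; see [mem_spectrum]. *)
Definition distinct_roots (R : rcfType) F : {poly scalars R F} -> seq (scalars R F) :=
  match F with
  | RealField => fun p => rootsR p
  | ComplexField => fun p => undup (sval (closed_field_poly_normal p))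
  end.

Definition spectrum (R : rcfType) F q (A : 'M[scalars R F]_q) :=
  distinct_roots (char_poly A).

(* The orthogonal projection onto the eigenspace of A for a: it projects along
   the orthogonal complement [kermx (adjmx E)] of the eigenspace E.  Row
   vectors are used, but for a self-adjoint A the orthogonal projections onto
   the row and onto the column eigenspaces are the same matrix. *)
Definition eigproj (R : rcfType) F q (A : 'M[scalars R F]_q) (a : scalars R F) :
    'M[scalars R F]_q :=
  let E := eigenspace A a in proj_mx E (kermx (adjmx E)).

Section Spectrum.
Variables (R : rcfType) (F : field_kind) (q : nat).
Local Notation K := (scalars R F).
Implicit Type A : 'M[K]_q.

Lemma spectrum_uniq A : uniq (spectrum A).
Proof.
rewrite /spectrum; move: (char_poly A); rewrite /distinct_roots.
by case: F => /= p; [exact: uniq_roots|exact: undup_uniq].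
Qed.

Lemma mem_spectrum A a : (a \in spectrum A) = eigenvalue A a.
Proof.
rewrite eigenvalue_root_char /spectrum.
have : char_poly A != 0 by rewrite monic_neq0 ?char_poly_monic.
move: (char_poly A) a; rewrite /distinct_roots.
case: F => /= p a p0; first by rewrite -roots_on_rootsR // in_itv.
rewrite mem_undup; case: closed_field_poly_normal => /= r Dp.
by rewrite [in RHS]Dp rootZ ?lead_coef_eq0 // root_prod_XsubC.
Qed.

Lemma mulmx_adj_eq0 m n (A : 'M[K]_(m, n)) : A *m adjmx A = 0 -> A = 0.
Proof.
move=> AA0; apply/matrixP=> i j; rewrite mxE.
have /eqP := congr1 (fun B : 'M_m => B i i) AA0; rewrite !mxE.
under eq_bigr do rewrite !mxE.
rewrite psumr_eq0; last by move=> k _; exact: mul_sconj_ge0.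
move=> /allP/(_ j (mem_index_enum _)) /=.
by rewrite mulf_eq0 fmorph_eq0 orbb => /eqP.
Qed.

Lemma cap_ortho_eq0 (E : 'M[K]_q) : (E :&: kermx (adjmx E))%MS = 0.
Proof.
set C := (E :&: _)%MS.
have /submxP[D CE] : (C <= E)%MS by exact: capmxSl.
have /sub_kermxP CK : (C <= kermx (adjmx E))%MS by exact: capmxSr.
by apply: mulmx_adj_eq0; rewrite [in X in _ *m X]CE adjmxM mulmxA CK mul0mx.
Qed.

Lemma add_ortho_full (E : 'M[K]_q) : (1%:M <= E + kermx (adjmx E))%MS.
Proof.
rewrite sub1mx /row_full.
have := mxrank_sum_cap E (kermx (adjmx E)).
rewrite cap_ortho_eq0 mxrank0 addn0 => ->.
rewrite mxrank_ker /adjmx mxrank_map mxrank_tr subnKC //.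
exact: rank_leq_row.
Qed.

Lemma eigproj_adj A a : adjmx (eigproj A a) = eigproj A a.
Proof.
rewrite /eigproj; set E := eigenspace A a; set P := proj_mx _ _.
have cap0 := cap_ortho_eq0 E.
have PE : (P <= E)%MS by rewrite -[P]mul1mx; exact: proj_mx_sub.
have QK : (1%:M - P <= kermx (adjmx E))%MS.
  have := @add_proj_mx _ _ _ E (kermx (adjmx E)) 1%:M cap0 (add_ortho_full E).
  rewrite !mul1mx => <-; rewrite addrAC subrr add0r -[X in (X <= _)%MS]mul1mx.
  exact: proj_mx_sub.
have PQ : (1%:M - P) *m adjmx P = 0.
  have /submxP[D PD] := PE; rewrite [in adjmx P]PD adjmxM mulmxA.
  by move/sub_kermxP: QK => ->; rewrite mul0mx.
move: PQ; rewrite mulmxBl mul1mx => /subr0_eq Pa.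
by clearbody P; rewrite -[RHS]adjmxK Pa adjmxM adjmxK.
Qed.

End Spectrum.

Section Gram.
Variables (R : rcfType) (F : field_kind) (n q : nat).
Variable O : 'I_n -> samx R F q.
Local Notation K := (scalars R F).

Definition gram_mx (S : 'M[K]_q) : 'M[K]_q :=
  n%:R^-1 *: \sum_(i < n) \sum_(l <- spectrum (O i))
    (\tr (S *m eigproj (O i) l) / \tr (eigproj (O i) l)) *: eigproj (O i) l.

Lemma gram_mx_adj (S : 'M[K]_q) : adjmx S = S -> adjmx (gram_mx S) = gram_mx S.
Proof.
move=> Sa; rewrite /gram_mx adjmxZ fmorphV rmorph_nat; congr (_ *: _).
have a0 : adjmx 0 = 0 :> 'M[K]_q by rewrite /adjmx trmx0 map_mx0.
rewrite (big_morph _ (@adjmxD _ _ _ _) a0); apply: eq_bigr => i _.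
rewrite (big_morph _ (@adjmxD _ _ _ _) a0); apply: eq_bigr => l _.
rewrite adjmxZ eigproj_adj; congr (_ *: _).
rewrite rmorphM fmorphV /= -!mxtrace_adj adjmxM eigproj_adj Sa.
by rewrite mxtrace_mulC.
Qed.

Lemma gram_mx_linear : linear gram_mx.
Proof.
move=> a S T; rewrite /gram_mx scalerA [a * _]mulrC -scalerA -scalerDr.
congr (_ *: _); rewrite scaler_sumr -big_split; apply: eq_bigr => i _ /=.
rewrite scaler_sumr -big_split; apply: eq_bigr => l _ /=.
rewrite mulmxDl -scalemxAl linearD linearZ /=.
by rewrite mulrDl scalerDl scalerA mulrA.
Qed.

(* [vsproj] only retypes [gram_mx S], which is self-adjoint: see [gramE]. *)
Definition gram_sa (S : samx R F q) : samx R F q :=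
  vsproj (selfadjoint R F q) (gram_mx S).

Fact gram_sa_linear : linear gram_sa.
Proof.
move=> a S T; rewrite /gram_sa -linearP; congr vsproj.
exact: gram_mx_linear.
Qed.
HB.instance Definition _ := GRing.isLinear.Build R _ _ _ gram_sa
  gram_sa_linear.

Definition gram : 'End(samx R F q) := linfun gram_sa.

Lemma gramE (S : samx R F q) : (gram S : samx R F q) = gram_mx S :> 'M_q.
Proof.
rewrite lfunE /= /mx_of_sa vsprojK // mem_selfadjoint.
by rewrite gram_mx_adj // mx_of_saP.
Qed.

Definition unitary_design (alpha : R) : Prop :=
  forall Delta : samx R F q, \tr Delta = 0 -> gram Delta = alpha *: Delta.

End Gram.

Definition alphaQ (R : rcfType) (F : field_kind) (q : nat) : R :=
  match F with
  | RealField => (q%:R / 2 + 1)^-1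
  | ComplexField => (q%:R + 1)^-1
  end.

(* Main.v *)
(* The Gram map G is a sum of the rank-one maps S |-> tr(S P)/tr(P) P, divided
   by n, over all eigenprojections P, each of trace tr(P P)/tr(P) = 1; this gives
   the trace of G. As the eigenprojections of a self-adjoint matrix sum to the
   identity, G fixes the identity and preserves traces. Being symmetric for
   (S, T) |-> tr(S T), it is diagonalizable over the reals; besides the
   eigenvalue 1 of the identity, its other dim - 1 eigenvalues sum to qbar - 1,
   hence have mean alpha, which bounds the smallest of them. If that bound is
   attained, they all equal alpha, so G - alpha has rank at most one with the
   identity in its image, and trace preservation makes it vanish on traceless
   matrices. Since qbar <= q, alpha < 1, so that 1 is never the minimum. *)
From HB Require Import structures.
Require Import Defs.
From mathcomp Require Import all_boot all_order all_algebra.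
From mathcomp Require Import complex.
From mathcomp Require Import reals.
From mathcomp Require Import ring lra.

Import Order.TTheory GRing.Theory Num.Theory.
Import passmx.
Local Open Scope ring_scope.
Set Implicit Arguments.
Unset Strict Implicit.
Unset Printing Implicit Defensive.

(** * Eigenvalues of operators that are symmetric for a positive definite form *)

Definition posdefmx (R : rcfType) F n (G : 'M[scalars R F]_n) : Prop :=
  forall v : 'rV_n, v != 0 -> 0 < (v *m G *m adjmx v) 0 0.

Lemma adjmx_real (R : rcfType) m n (A : 'M[R]_(m, n)) :
  @adjmx R RealField m n A = A^T.
Proof. by apply/matrixP => i j; rewrite !mxE. Qed.

Lemma closed_eigenvalue (C : closedFieldType) n (A : 'M[C]_n) :
  (0 < n)%N -> exists a, eigenvalue A a.
Proof.
move=> n_gt0; have /closed_rootP[a] : size (char_poly A) != 1%N.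
  by rewrite size_char_poly eqSS -lt0n.
by rewrite -eigenvalue_root_char; exists a.
Qed.

(* If u + i w is a complex eigenvector for x + i y, symmetry of D with respect
   to G forces y * (u G u^T + w G w^T) = 0, hence y = 0. *)
Lemma symmetric_eigenvalue (R : rcfType) n (D G : 'M[R]_n) :
  (0 < n)%N -> (forall v : 'rV_n, v != 0 -> 0 < (v *m G *m v^T) 0 0) ->
  G^T = G -> (D *m G)^T = D *m G -> exists a, eigenvalue D a.
Proof.
move=> n_gt0 Gpos GT DGT.
pose toC := real_complex R.
have [[x y] /eigenvalueP[v vD v_n0]] := closed_eigenvalue (map_mx toC D) n_gt0.
pose u : 'rV_n := map_mx (@complex.Re R) v.
pose w : 'rV_n := map_mx (@complex.Im R) v.
have uvw (i : 'I_1) j : v i j = Complex (u i j) (w i j).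
  by rewrite !mxE; case: (v i j).
have [uD wD] : u *m D = x *: u - y *: w /\ w *m D = y *: u + x *: w.
  have vDE j : \sum_k v 0 k * (D k j)%:C%C = Complex x y * v 0 j.
    have /rowP/(_ j) := vD; rewrite !mxE => <-.
    by apply: eq_bigr => k _; rewrite mxE.
  split; apply/rowP=> j; rewrite !mxE.
    transitivity (complex.Re (\sum_k v 0 k * (D k j)%:C%C)).
      rewrite raddf_sum; apply: eq_bigr => k _; rewrite uvw /=.
      by rewrite mulr0 subr0.
    by rewrite vDE; case: (v 0 j).
  transitivity (complex.Im (\sum_k v 0 k * (D k j)%:C%C)).
    rewrite raddf_sum; apply: eq_bigr => k _; rewrite uvw /=.
    by rewrite mulr0 add0r.
  by rewrite vDE; case: (v 0 j) => a b /=; rewrite addrC.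
pose B (s t : 'rV[R]_n) := (s *m G *m t^T) 0 0.
have Bsym s t : B s t = B t s.
  transitivity ((s *m G *m t^T)^T 0 0); first by rewrite mxE.
  by rewrite !trmx_mul !trmxK GT mulmxA.
have BD s t : B (s *m D) t = B s (t *m D).
  rewrite /B trmx_mul !mulmxA -[s *m D *m G]mulmxA -DGT trmx_mul GT.
  by rewrite !mulmxA.
have BDl s t z : B (s + t) z = B s z + B t z by rewrite /B !mulmxDl mxE.
have BZl a s z : B (a *: s) z = a * B s z by rewrite /B -!scalemxAl mxE.
have BDr s t z : B z (s + t) = B z s + B z t by rewrite Bsym BDl !(Bsym z).
have BZr a s z : B z (a *: s) = a * B z s by rewrite Bsym BZl Bsym.
have B_ge0 s : 0 <= B s s.
  by have [->|/Gpos/ltW//] := eqVneq s 0; rewrite /B !mul0mx mxE.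
have y0 : y = 0.
  have := BD u w; rewrite uD wD -scaleNr BDl BDr !BZl !BZr => E.
  have {E} /eqP : y * (B u u + B w w) = 0 by lra.
  rewrite mulf_eq0 => /orP[/eqP//|]; rewrite paddr_eq0 ?B_ge0// => /andP[u0 w0].
  have uw0 : u = 0 /\ w = 0.
    by split; apply/eqP; apply: contraT => /Gpos; rewrite -/(B _ _);
      [rewrite (eqP u0)|rewrite (eqP w0)]; rewrite ltxx.
  case/eqP: v_n0; apply/rowP => j; rewrite uvw.
  by rewrite uw0.1 uw0.2 !mxE.
exists x; apply/eigenvalueP.
rewrite y0 !scale0r subr0 add0r in uD wD.
(* With y = 0, both [u] and [w] satisfy the eigenvector equation for [x], and one of them is
   nonzero. *)
have [u0|u0] := eqVneq u 0; last by exists u.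
exists w => //; apply: contraNneq v_n0 => w0.
by apply/eqP/rowP => j; rewrite uvw u0 w0 !mxE.
Qed.

(** * Spectral theorem for self-adjoint matrices *)

Section HermitianSpectrum.
Variables (R : rcfType) (F : field_kind).
Local Notation K := (scalars R F).

(** A general form [G] is allowed, not only the identity, so that the result applies to the
    restriction of an operator to an invariant subspace with an arbitrary basis. *)
Lemma hermitian_eigenvalue n (D G : 'M[K]_n) :
  (0 < n)%N -> posdefmx G -> adjmx G = G -> adjmx (D *m G) = D *m G ->
  exists a, eigenvalue D a.
Proof.
case: F D G => D G n_gt0 Gpos GT DGT; last exact: (closed_eigenvalue D).
rewrite !adjmx_real in GT DGT; apply: (symmetric_eigenvalue n_gt0 _ GT DGT).
by move=> v /Gpos; rewrite adjmx_real.
Qed.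

(* The G-orthocomplement of the sum W of the eigenspaces is invariant, so it
   would contain an eigenvector if it were nonzero. *)
Lemma hermitian_sum_eigenspace n (M G : 'M[K]_n) :
  posdefmx G -> adjmx G = G -> adjmx (M *m G) = M *m G ->
  (1%:M <= \sum_(a <- spectrum M) eigenspace M a)%MS.
Proof.
move=> Gpos GT MGT; set W := (\sum_(a <- _) _)%MS.
have Wsup a : a \in spectrum M -> (eigenspace M a <= W)%MS.
  by move=> aM; rewrite /W (big_rem a) //= addsmxSl.
have WM : (W *m M <= W)%MS.
  rewrite /W; elim: (spectrum M) => [|a s IHs]; first by rewrite big_nil mul0mx.
  rewrite big_cons addsmxMr (addsmxS _ IHs) //.
  by have /eigenspaceP-> := submx_refl (eigenspace M a); exact: scalemx_sub.
set U := kermx (G *m adjmx W).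
have UW : U *m G *m adjmx W = 0 by rewrite -mulmxA mulmx_ker.
have UM : (U *m M <= U)%MS.
  apply/sub_kermxP; rewrite !mulmxA -[U *m M *m G]mulmxA -MGT adjmxM GT.
  have /submxP[D WMD] := WM.
  by rewrite -!mulmxA -adjmxM WMD adjmxM !mulmxA UW mul0mx.
(* If [U] is zero, [G *m adjmx W] has full row rank, which forces [W] to have rank n. *)
have [U0|U_n0] := eqVneq U 0.
  have : row_free (G *m adjmx W) by rewrite -kermx_eq0 -/U U0.
  rewrite sub1mx /row_full /row_free => /eqP rG; rewrite eqn_leq rank_leq_row.
  by rewrite -{1}rG (leq_trans (mxrankM_maxr _ _)) //= /adjmx mxrank_map mxrank_tr.
have [C CU Cfree] : exists2 C : 'M_(\rank U, n), (C :=: U)%MS & row_free C.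
  by exists (row_base U); [exact: eq_row_base|exact: row_base_free].
(* [D] is the matrix of [M] on [U] in the basis [C], and [C *m G *m adjmx C] is that of the
   restricted form. *)
have /submxP[D CMD] : (C *m M <= C)%MS.
  by rewrite CU (submx_trans _ UM) // submxMr // CU.
have Cinj (v : 'rV_(\rank U)) : v != 0 -> v *m C != 0.
  by apply: contraNneq => vC; apply/eqP/(row_free_inj Cfree); rewrite vC mul0mx.
have [a /eigenvalueP[v vD v_n0]] : exists a, eigenvalue D a.
  apply: (@hermitian_eigenvalue _ D (C *m G *m adjmx C)).
  - by rewrite lt0n mxrank_eq0.
  - by move=> v /Cinj/Gpos; rewrite adjmxM !mulmxA.
  - by rewrite !adjmxM adjmxK GT mulmxA.
  - by rewrite !mulmxA -CMD -[C *m M *m G]mulmxA 2!adjmxM MGT adjmxK mulmxA.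
have vCM : v *m C *m M = a *: (v *m C) by rewrite -mulmxA CMD mulmxA vD scalemxAl.
have aM : a \in spectrum M.
  by rewrite mem_spectrum; apply/eigenvalueP; exists (v *m C); rewrite ?Cinj.
have /submxP[X vCX] : (v *m C <= W)%MS.
  by rewrite (submx_trans _ (Wsup _ aM)) //; apply/eigenspaceP.
have /submxP[Y vCY] : (v *m C <= U)%MS by rewrite mulmx_sub // CU.
have := Gpos _ (Cinj _ v_n0).
rewrite {2}vCX adjmxM mulmxA vCY -[Y *m U *m G]mulmxA -[Y *m _ *m _]mulmxA UW.
by rewrite mulmx0 mul0mx mxE ltxx.
Qed.

(** This trace is the sum of the squared moduli of the entries. *)
Lemma mxtrace_adj_gt0 m n (A : 'M[K]_(m, n)) : A != 0 -> 0 < \tr (A *m adjmx A).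
Proof.
have trE : \tr (A *m adjmx A) = \sum_i \sum_j A i j * sconj (A i j).
  by apply: eq_bigr => i _; rewrite mxE; apply: eq_bigr => j _; rewrite !mxE.
have row_ge0 i : 0 <= \sum_j A i j * sconj (A i j).
  by apply: sumr_ge0 => j _; exact: mul_sconj_ge0.
move=> A_n0; rewrite lt_neqAle trE sumr_ge0 // andbT eq_sym.
apply: contraNneq A_n0 => /eqP; rewrite psumr_eq0 // => /allP A0.
apply/eqP/matrixP => i j; rewrite mxE.
have := A0 i (mem_index_enum _).
rewrite /= psumr_eq0; last by move=> k _; exact: mul_sconj_ge0.
move=> /allP/(_ j (mem_index_enum _)) /=.
by rewrite mulf_eq0 fmorph_eq0 orbb => /eqP.
Qed.

Lemma posdefmx1 n : @posdefmx R F n 1%:M.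
Proof.
by move=> v /mxtrace_adj_gt0; rewrite mulmx1 trace_mx11.
Qed.

Section EigenProjections.
Variables (q : nat) (A : 'M[K]_q).
Hypothesis adjA : adjmx A = A.

(** For an eigenvector v, the product v A v^* equals both a v v^* and conj(a) v v^*. *)
Lemma sconj_eigenvalue a : eigenvalue A a -> sconj a = a.
Proof.
case/eigenvalueP=> v vA v_n0.
have : a *: (v *m adjmx v) = sconj a *: (v *m adjmx v).
  by rewrite scalemxAl -vA scalemxAr -adjmxZ -vA adjmxM adjA mulmxA.
move/eqP; rewrite -subr_eq0 -scalerBl scalemx_eq0 subr_eq0 => /orP[/eqP//|].
by move=> /eqP/mulmx_adj_eq0 v0; rewrite v0 eqxx in v_n0.
Qed.

Lemma eigproj_id a m (u : 'M_(m, q)) : 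
  (u <= eigenspace A a)%MS -> u *m eigproj A a = u.
Proof. exact: proj_mx_id (cap_ortho_eq0 _). Qed.

Lemma eigproj_idem a : eigproj A a *m eigproj A a = eigproj A a.
Proof. exact: proj_mx_proj (cap_ortho_eq0 _). Qed.

(** Eigenspaces for distinct eigenvalues are orthogonal: moving [A] across the product of [u] with
    the adjoint of the other eigenspace multiplies it by a on one side and by b on the other. *)
Lemma eigproj_ortho a b m (u : 'M_(m, q)) : eigenvalue A a -> eigenvalue A b ->
  a != b -> (u <= eigenspace A a)%MS -> u *m eigproj A b = 0.
Proof.
move=> ev_a ev_b ab /eigenspaceP uA; apply: proj_mx_0 (cap_ortho_eq0 _) _.
apply/sub_kermxP; set E := eigenspace A b.
have EA : E *m A = b *: E by apply/eigenspaceP; exact: submx_refl.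
have : a *: (u *m adjmx E) = b *: (u *m adjmx E).
  rewrite scalemxAl -uA -mulmxA -[X in _ *m (X *m _)]adjA -adjmxM EA adjmxZ.
  by rewrite sconj_eigenvalue // scalemxAr.
move/eqP; rewrite -subr_eq0 -scalerBl scalemx_eq0 subr_eq0 (negPf ab) /=.
by move/eqP.
Qed.

(** A self-adjoint idempotent P satisfies P = P P^*, so its trace is a squared norm. This justifies
    the divisions by traces in [gram_mx]. *)
Lemma mxtrace_eigproj_gt0 a : eigenvalue A a -> 0 < \tr (eigproj A a).
Proof.
case/eigenvalueP=> v vA v_n0.
rewrite -eigproj_idem -[X in _ *m X]eigproj_adj; apply: mxtrace_adj_gt0.
apply: contraNneq v_n0 => P0; rewrite -(@eigproj_id a _ v) ?P0 ?mulmx0 //.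
by apply/eigenspaceP.
Qed.

(** On the eigenspace for a, the projection for a acts as the identity and the others vanish; the
    eigenspaces span the whole space. *)
Lemma sum_eigproj : \sum_(a <- spectrum A) eigproj A a = 1%:M.
Proof.
set S := \sum_(a <- _) _.
have sub1 : (1%:M <= \sum_(a <- spectrum A) eigenspace A a)%MS.
  by apply: hermitian_sum_eigenspace (@posdefmx1 q) _ _; rewrite ?adjmx1 ?mulmx1.
have : (1%:M <= kermx (S - 1%:M))%MS.
  apply: submx_trans sub1 _; rewrite big_seq.
  apply: (big_ind (fun X : 'M_q => (X <= kermx (S - 1%:M))%MS)).
  - exact: sub0mx.
  - by move=> X Y XS YS; rewrite addsmx_sub XS.
  move=> a aA; apply/sub_kermxP; rewrite mulmxBr mulmx1 /S (big_rem a) //=.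
  rewrite mulmxDr eigproj_id // addrAC subrr add0r mulmx_sumr big_seq big1 // => b.
  rewrite mem_rem_uniq ?spectrum_uniq // => /andP[ba bA].
  by apply: (@eigproj_ortho a); rewrite -?mem_spectrum // eq_sym.
by move/sub_kermxP/eqP; rewrite mul1mx subr_eq0 => /eqP.
Qed.

Lemma size_spectrum : (size (spectrum A) <= q)%N.
Proof.
rewrite -ltnS -(size_char_poly A); apply: max_poly_roots (spectrum_uniq A).
  by rewrite monic_neq0 ?char_poly_monic.
by apply/allP => a; rewrite mem_spectrum eigenvalue_root_char.
Qed.

End EigenProjections.
End HermitianSpectrum.

(** * Traces and the dimension of the space of self-adjoint matrices *)

(** Expanding each [v k] in the basis and exchanging the two sums turns the right-hand side into the
    sum of the diagonal entries of the matrix of [f]. *)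
Lemma lftrace_sum_rank1 (K : fieldType) (vT : vectType K) (f : 'End(vT))
    I (r : seq I) (phi : I -> vT -> K) (v : I -> vT) :
  (forall k, scalar (phi k)) ->
  (forall x, f x = \sum_(k <- r) phi k x *: v k) ->
  lftrace f = \sum_(k <- r) phi k (v k).
Proof.
move=> phi_lin fE; set e := vbasis {:vT}.
have phi_sum k x : phi k x = \sum_i coord e i x * phi k e`_i.
  pose L := GRing.isLinear.Build _ _ _ _ (phi k) (phi_lin k).
  pose g : {scalar vT} := HB.pack (phi k) L.
  rewrite -[phi k]/(g : vT -> K) {1}(coord_vbasis (memvf x)) linear_sum.
  by apply: eq_bigr => i _; rewrite linearZ.
under [RHS]eq_bigr do rewrite phi_sum.
rewrite exchange_big /lftrace; apply: eq_bigr => i _ /=.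
rewrite !mxE /= vecof_delta fE linear_sum.
by apply: eq_bigr => k _; rewrite linearZ /= mulrC.
Qed.

Lemma lftrace1 (K : fieldType) (vT : vectType K) :
  lftrace (\1%VF : 'End(vT)) = (\dim {:vT})%:R.
Proof. by rewrite /lftrace mxof1 ?mxtrace1 // (basis_free (vbasisP _)). Qed.

Section RealPart.
Variables (R : rcfType) (F : field_kind).
Local Notation K := (scalars R F).

(** Linear functionals on [samx] take values in [R], while traces live in [K]; on scalars fixed by
    [sconj] this map inverts [of_real]. *)
Definition real_part : K -> R :=
  match F with RealField => fun x => x | ComplexField => @complex.Re R end.

Lemma real_partD x y : real_part (x + y) = real_part x + real_part y.
Proof. by rewrite /real_part; case: F x y => // -[? ?] [? ?]. Qed.

Lemma real_partM a x : real_part (of_real F a * x) = a * real_part x.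
Proof.
by rewrite /real_part /of_real; case: F x => // -[x y] /=; rewrite mul0r subr0.
Qed.

Lemma of_realK : cancel (of_real F) real_part.
Proof. by rewrite /real_part /of_real; case: F. Qed.

Lemma real_partK x : sconj x = x -> of_real F (real_part x) = x.
Proof.
rewrite /real_part /of_real /sconj; case: F x => // -[x y] [yN].
by have -> : y = 0 by lra.
Qed.

Lemma real_part_gt0 x : 0 < x -> 0 < real_part x.
Proof. by rewrite /real_part; case: F x => // -[x y]; rewrite ltcE => /andP[]. Qed.

(** An orthonormal basis of [K] over [R] for the form Re(conj c * x); it lets both fields share one
    dimension count. *)
Definition scalar_basis : seq K :=
  match F with RealField => [:: 1] | ComplexField => [:: 1; Complex 0 1] end.

Lemma scalar_basisP x :
  x = \sum_(c <- scalar_basis) of_real F (real_part (sconj c * x)) * c.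
Proof.
rewrite /scalar_basis /real_part /of_real /sconj.
case: F x => [x|[x y]]; rewrite !big_cons big_nil addr0; first by rewrite mul1r mulr1.
by simpc; congr Complex; lra.
Qed.

End RealPart.

Section SelfAdjointSpace.
Variables (R : rcfType) (F : field_kind) (q : nat).
Local Notation K := (scalars R F).
Local Notation V := (samx R F q).

Lemma mx_of_sa0 : (0 : V) = 0 :> 'M[K]_q.
Proof. exact: (linear0 (@vsval _ _ (selfadjoint R F q))). Qed.

Lemma mx_of_saB (S T : V) : (S - T : V) = (S : 'M[K]_q) - (T : 'M[K]_q) :> 'M_q.
Proof. exact: (linearB (@vsval _ _ (selfadjoint R F q))). Qed.

Lemma mx_of_saD (S T : V) : (S + T : V) = (S : 'M[K]_q) + (T : 'M[K]_q) :> 'M_q.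
Proof. exact: (linearD (@vsval _ _ (selfadjoint R F q))). Qed.

Lemma mx_of_saZ a (S : V) : (a *: S : V) = of_real F a *: (S : 'M[K]_q) :> 'M_q.
Proof. exact: (linearZ_LR (@vsval _ _ (selfadjoint R F q))). Qed.

Lemma mx_of_sa_sum I (r : seq I) (S : I -> V) :
  (\sum_(k <- r) S k : V) = \sum_(k <- r) (S k : 'M[K]_q) :> 'M_q.
Proof. exact: (linear_sum (@vsval _ _ (selfadjoint R F q))). Qed.

Lemma mx_of_sa_inj : injective (@mx_of_sa R F q).
Proof. exact: (@subvs_inj _ _ (selfadjoint R F q)). Qed.

(** Applied only to self-adjoint matrices, where it is a mere change of type. *)
Definition sa_of_mx (A : 'M[K]_q) : V := vsproj (selfadjoint R F q) A.

Lemma sa_of_mxK A : adjmx A = A -> sa_of_mx A = A :> 'M_q.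
Proof. by move=> AA; rewrite /mx_of_sa vsprojK // mem_selfadjoint AA. Qed.

Lemma real_mxtrace_scalar (X : 'M[K]_q) :
  scalar (fun S : V => real_part (\tr (S *m X))).
Proof.
move=> a S T; rewrite mx_of_saD mx_of_saZ mulmxDl -scalemxAl linearD linearZ /=.
by rewrite real_partD real_partM.
Qed.

Lemma lftrace_sa (f : 'End(V)) I (r : seq I) (X A : I -> 'M[K]_q) :
  (forall k, adjmx (A k) = A k) ->
  (forall S : V, (f S : V) =
    \sum_(k <- r) of_real F (real_part (\tr (S *m X k))) *: A k :> 'M_q) ->
  lftrace f = \sum_(k <- r) real_part (\tr (A k *m X k)).
Proof.
move=> AA fE; rewrite (@lftrace_sum_rank1 _ _ f _ r
  (fun k S => real_part (\tr ((S : V) *m X k))) (fun k => sa_of_mx (A k))).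
- by apply: eq_bigr => k _; rewrite sa_of_mxK.
- by move=> k; exact: real_mxtrace_scalar.
move=> S; apply: mx_of_sa_inj; rewrite fE mx_of_sa_sum.
by apply: eq_bigr => k _; rewrite mx_of_saZ sa_of_mxK.
Qed.

(* The dimension is the trace of the identity, a sum of the rank-one maps
   S |-> real_part (conj c * S i j) *: (c *: E_ij + conj c *: E_ji) / 2. *)
Lemma dim_samx_sum : (\dim {:V})%:R =
  \sum_(c <- scalar_basis R F) \sum_(p : 'I_q * 'I_q)
     (real_part (sconj c * c) +
      (p.1 == p.2)%:R * real_part (sconj c * sconj c)) / 2.
Proof.
pose r := [seq (c, p) | c <- scalar_basis R F, p <- index_enum ('I_q * 'I_q)%type].
pose Y (k : K * ('I_q * 'I_q)) : 'M[K]_q := k.1 *: delta_mx k.2.1 k.2.2.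
pose X (k : K * ('I_q * 'I_q)) : 'M[K]_q := sconj k.1 *: delta_mx k.2.2 k.2.1.
have trX (A : 'M[K]_q) k : \tr (A *m X k) = sconj k.1 * A k.2.1 k.2.2.
  rewrite -scalemxAr linearZ /=; congr (_ * _).
  rewrite /mxtrace (bigD1 k.2.1) //= big1 => [|i ik]; rewrite mxE (bigD1 k.2.2) //= big1.
  - by rewrite mxE !eqxx mulr1 !addr0.
  - by move=> j jk; rewrite mxE (negPf jk) mulr0.
  - by rewrite mxE (negPf ik) andbF mulr0 addr0.
  - by move=> j jk; rewrite mxE (negPf jk) mulr0.
have adjY k : adjmx (Y k) = X k.
  by rewrite adjmxZ; congr (_ *: _); apply/matrixP => i j; rewrite !mxE rmorph_nat andbC.
pose A k := of_real F 2^-1 *: (Y k + X k).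
rewrite -lftrace1 (@lftrace_sa _ _ r X A).
- rewrite big_allpairs; apply: eq_bigr => c _; apply: eq_bigr => -[i j] _.
  rewrite trX !mxE /= !eqxx mulrCA real_partM mulrC; congr (_ / _).
  rewrite mulr1 mulrDr real_partD; congr (_ + _).
  rewrite mulrA -[_%:R as X in _ * X](rmorph_nat (of_real F)) mulrC real_partM.
  by rewrite [j == i]eq_sym andbb.
- by move=> k; rewrite /A adjmxZ sconj_of_real adjmxD -adjY adjmxK addrC.
move=> S; rewrite lfunE /=.
(* [S] expands along the [Y k]; taking adjoints gives an expansion along the [X k] with the same
   real coefficients. The average of the two involves only the self-adjoint [A k]. *)
have SY : S = \sum_(k <- r) of_real F (real_part (\tr (S *m X k))) *: Y k :> 'M_q.
  rewrite big_allpairs exchange_big /= [LHS]matrix_sum_delta pair_big /=.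
  apply: eq_bigr => -[i j] _; rewrite [in LHS](scalar_basisP (S i j)) scaler_suml.
  by apply: eq_bigr => c _; rewrite trX scalerA.
have SX : S = \sum_(k <- r) of_real F (real_part (\tr (S *m X k))) *: X k :> 'M_q.
  rewrite -[LHS]mx_of_saP [in LHS]SY.
  have a0 : adjmx 0 = 0 :> 'M[K]_q by rewrite /adjmx trmx0 map_mx0.
  rewrite (big_morph _ (@adjmxD _ _ _ _) a0); apply: eq_bigr => k _.
  by rewrite adjmxZ sconj_of_real adjY.
under eq_bigr do rewrite scalerA mulrC -scalerA scalerDr.
rewrite -scaler_sumr big_split /= -SX -SY.
rewrite -mulr2n -scaler_nat scalerA -(rmorph_nat (of_real F)) -rmorphM.
rewrite mulVf ?rmorph1 ?scale1r //.
by rewrite pnatr_eq0.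
Qed.

(** Over the complex numbers, conj(c)^2 is 1 for c = 1 and -1 for c = i, so the diagonal corrections
    cancel; over the reals they add q / 2. *)
Lemma dim_samx : (\dim {:V})%:R =
  match F with RealField => q%:R * (q%:R + 1) / 2 | ComplexField => q%:R ^+ 2 end :> R.
Proof.
have sum1 a b : \sum_(p : 'I_q * 'I_q) (a + (p.1 == p.2)%:R * b) / 2
    = (q%:R ^+ 2 * a + q%:R * b) / 2 :> R.
  rewrite -mulr_suml; congr (_ / _); rewrite big_split /= sumr_const card_prod card_ord.
  rewrite -[a *+ _]mulr_natl natrM; congr (_ + _); rewrite -mulr_suml; congr (_ * _).
  rewrite -(pair_bigA _ (fun i j : 'I_q => (i == j)%:R)) /=.
  transitivity (\sum_(i < q) 1 : R); last by rewrite sumr_const card_ord.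
  apply: eq_bigr => i _; rewrite (bigD1 i) //= eqxx big1 ?addr0 // => j ji.
  by rewrite eq_sym (negPf ji).
rewrite dim_samx_sum /scalar_basis /real_part /sconj.
by case: F; rewrite !big_cons big_nil !sum1 /=; field.
Qed.

End SelfAdjointSpace.

(** * Diagonalization of endomorphisms that are symmetric for an inner product *)

Lemma symmetric_diagonalizable (R : rcfType) (vT : vectType R) (f : 'End(vT))
    (e : (\dim {:vT}).-tuple vT) (B : vT -> vT -> R) :
  basis_of {:vT} e ->
  (forall y, scalar (B^~ y)) -> (forall x y, B x y = B y x) ->
  (forall x : vT, x != 0 -> 0 < B x x) -> (forall x y, B (f x) y = B x (f y)) ->
  exists P d, P \in unitmx /\ mxof e e f = invmx P *m diag_mx d *m P.
Proof.
move=> e_basis Blin Bsym Bpos Bf; set M := mxof e e f.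
have e_free := basis_free e_basis.
have B_suml (v : 'rV_(\dim {:vT})) y : B (vecof e v) y = \sum_i v 0 i * B e`_i y.
  pose L := GRing.isLinear.Build _ _ _ _ (B^~ y) (Blin y).
  pose g : {scalar vT} := HB.pack (B^~ y) L.
  rewrite -[B _ y]/(g (vecof e v)) linear_sum.
  by apply: eq_bigr => i _; rewrite linearZ.
(* The matrix of [B] in the basis [e]: symmetry of [f] for [B] becomes symmetry of [M *m G]. *)
pose G : 'M[R]_(\dim {:vT}) := \matrix_(i, j) B e`_i e`_j.
have GE (u v : 'rV_(\dim {:vT})) : (u *m G *m v^T) 0 0 = B (vecof e u) (vecof e v).
  rewrite mxE [RHS]Bsym B_suml; apply: eq_bigr => j _.
  rewrite Bsym B_suml !mxE mulrC; congr (_ * _).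
  by apply: eq_bigr => i _; rewrite mxE.
have MGE (u v : 'rV_(\dim {:vT})) :
    (u *m (M *m G) *m v^T) 0 0 = B (f (vecof e u)) (vecof e v).
  by rewrite mulmxA GE mul_mxof rVofK.
have entryE (A : 'M[R]_(\dim {:vT})) i j :
    A i j = ((delta_mx 0 i : 'rV_(\dim {:vT})) *m A *m
             (delta_mx 0 j : 'rV_(\dim {:vT}))^T) 0 0.
  by rewrite trmx_delta -rowE -colE !mxE.
have sumM : (1%:M <= \sum_(a <- @spectrum R RealField _ M) eigenspace M a)%MS.
  apply: (@hermitian_sum_eigenspace R RealField _ M G).
  - by move=> v v_n0; rewrite adjmx_real GE Bpos // vecof_eq0.
  - by rewrite adjmx_real; apply/matrixP => i j; rewrite !mxE Bsym.
  - rewrite adjmx_real; apply/matrixP => i j.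
    by rewrite mxE (entryE _ i j) (entryE _ j i) !MGE Bf Bsym.
have /diagonalizablePeigen[P Punit /(similar_diagLR Punit)[d Md]] :
    exists2 rs, uniq rs & (\sum_(a <- rs) eigenspace M a :=: 1%:M)%MS.
  exists (@spectrum R RealField _ M); first exact: spectrum_uniq.
  by apply/eqmxP; rewrite submx1.
by exists P, d; rewrite Md conjumx ?unitmx_inv // invmxK.
Qed.

(** * The Gram superoperator *)

Section GramSpectrum.
Variables (R : rcfType) (F : field_kind) (n q : nat) (O : 'I_n -> samx R F q).
Hypotheses (n_gt0 : (0 < n)%N).
Local Notation K := (scalars R F).
Local Notation V := (samx R F q).

Let nK_neq0 : n%:R != 0 :> K. Proof. by rewrite pnatr_eq0 -lt0n. Qed.

Lemma mxtrace_gram_mx (S : 'M[K]_q) : \tr (gram_mx O S) = \tr S.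
Proof.
rewrite /gram_mx linearZ /= linear_sum /= (eq_bigr (fun=> \tr S)) => [|i _].
  by rewrite sumr_const card_ord -[\tr S *+ n]mulr_natl mulKf.
rewrite linear_sum /= -[S in RHS]mulmx1 -(sum_eigproj (mx_of_saP (O i))).
rewrite mulmx_sumr linear_sum /= !big_seq; apply: eq_bigr => a.
rewrite mem_spectrum => /mxtrace_eigproj_gt0/lt0r_neq0 tr_n0.
by rewrite linearZ /= divfK.
Qed.

Lemma gram_mx1 : gram_mx O 1%:M = 1%:M.
Proof.
rewrite /gram_mx (eq_bigr (fun=> 1%:M)) => [|i _].
  by rewrite sumr_const card_ord -scaler_nat scalerA mulVf ?scale1r.
rewrite -[RHS](sum_eigproj (mx_of_saP (O i))) !big_seq; apply: eq_bigr => a.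
rewrite mem_spectrum => /mxtrace_eigproj_gt0/lt0r_neq0 tr_n0.
by rewrite mul1mx divff ?scale1r.
Qed.

(** Each eigenprojection P contributes tr(S P) tr(P T) / tr(P), which is symmetric in S and T. *)
Lemma mxtrace_gram_mxC (S T : 'M[K]_q) :
  \tr (gram_mx O S *m T) = \tr (S *m gram_mx O T).
Proof.
rewrite /gram_mx -scalemxAl -scalemxAr !linearZ /=; congr (_ * _).
rewrite mulmx_suml mulmx_sumr !linear_sum; apply: eq_bigr => i _.
rewrite mulmx_suml mulmx_sumr !linear_sum; apply: eq_bigr => a _ /=.
rewrite -scalemxAl -scalemxAr !linearZ /= [\tr (T *m _)]mxtrace_mulC.
by rewrite [LHS]mulrC mulrA mulrAC.
Qed.

Lemma lftrace_gram :
  lftrace (gram O) = n%:R^-1 * \sum_(i < n) (size (spectrum (O i)))%:R.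
Proof.
pose r := [seq (i, a) | i <- index_enum 'I_n, a <- spectrum (O i)].
pose P (k : 'I_n * K) := eigproj (O k.1) k.2.
pose X k := (n%:R^-1 / \tr (P k)) *: P k.
rewrite (@lftrace_sa _ _ _ _ _ r X P); first last.
- move=> S; rewrite gramE /gram_mx big_allpairs_dep scaler_sumr.
  apply: eq_bigr => i _; rewrite scaler_sumr; apply: eq_bigr => a _.
  rewrite scalerA; congr (_ *: _).
  (* The coefficient is a real scalar, being fixed by [sconj] as checked next, so taking its real
     part loses nothing. *)
  rewrite -scalemxAr linearZ /= real_partK /P /=; first by rewrite mulrA mulrAC.
  rewrite /P /= !rmorphM !fmorphV rmorph_nat /= -!mxtrace_adj eigproj_adj.
  by rewrite adjmxM eigproj_adj mx_of_saP [\tr (_ *m S)]mxtrace_mulC.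
- by move=> k; exact: eigproj_adj.
rewrite big_allpairs_dep mulr_sumr; apply: eq_bigr => i _.
rewrite (eq_big_seq (fun=> n%:R^-1)) => [|a].
  by rewrite big_const_seq count_predT iter_addr_0 mulr_natr.
rewrite mem_spectrum => /mxtrace_eigproj_gt0/lt0r_neq0 tr_n0.
rewrite -scalemxAr linearZ /= /P /= eigproj_idem divfK //.
by rewrite -(rmorph_nat (of_real F)) -fmorphV of_realK.
Qed.

End GramSpectrum.

(** * Eigenvalues read off a diagonal form, and their mean *)

Lemma eigenvalue_conj_diag (K : fieldType) N (M P : 'M[K]_N) (d : 'rV_N) a :
  P \in unitmx -> M = invmx P *m diag_mx d *m P ->
  eigenvalue M a <-> exists j, d 0 j = a.
Proof.
move=> Pu ->; split=> [/eigenvalueP[v vM v_n0]|[j <-]].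
  pose w := v *m invmx P.
  have w_n0 : w != 0.
    apply: contraNneq v_n0 => w0; apply/eqP.
    by rewrite -(mulmxKV Pu v) -/w w0 mul0mx.
  have wE : w *m diag_mx d = a *: w.
    by rewrite /w scalemxAl -vM !mulmxA mulmxK.
  have /rV0Pn[j wj] := w_n0; exists j; apply: (mulfI wj).
  by move: wE; clearbody w => /rowP/(_ j); rewrite mul_mx_diag !mxE [a * _]mulrC.
apply/eigenvalueP; exists (delta_mx 0 j *m P).
  rewrite !mulmxA mulmxK // scalemxAl; congr (_ *m _).
  apply/rowP => k; rewrite mul_mx_diag !mxE eqxx /=.
  by case: eqP => [->|_]; rewrite ?mul1r ?mulr1 ?mul0r ?mulr0.
apply/eqP => /(congr1 (mulmx^~ (invmx P))); rewrite mulmxK // mul0mx => /rowP/(_ j).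
by rewrite !mxE !eqxx => /eqP; rewrite oner_eq0.
Qed.

Lemma leigenvalueP (K : fieldType) (vT : vectType K) (f : 'End(vT)) a :
  reflect (exists2 v, f v = a *: v & v != 0) (leigenvalue f a).
Proof.
have kerE v : (v \in leigenspace f a) = (f v == a *: v).
  by rewrite memv_ker !lfun_simp subr_eq0.
apply: (iffP idP) => [E_n0|[v /eqP fv v_n0]].
  exists (vpick (leigenspace f a)); last by rewrite vpick0.
  by apply/eqP; rewrite -kerE memv_pick.
by apply: contraNneq v_n0 => E0; rewrite -memv0 -E0 kerE.
Qed.

Lemma leigenvalue_mxof (K : fieldType) (vT : vectType K) (f : 'End(vT))
    (e : (\dim {:vT}).-tuple vT) a :
  basis_of {:vT} e -> leigenvalue f a = eigenvalue (mxof e e f) a.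
Proof. by move=> eb; rewrite /leigenvalue (leigenspaceE eb) vsof_eq0. Qed.

(** The N - 1 values other than [d j0] have mean [m]. Their excesses over the minimum are
    nonnegative and sum to (N - 1)(m - d j1); if this sum is zero, every excess vanishes. *)
Lemma min_le_mean (R : realFieldType) N (d : 'I_N -> R) j0 j1 m :
  (1 < N)%N -> d j0 = 1 -> m < 1 -> (forall j, d j1 <= d j) ->
  \sum_j d j = 1 + (N%:R - 1) * m ->
  d j1 <= m /\ (d j1 = m -> forall j, j != j0 -> d j = m).
Proof.
move=> N_gt1 dj0 m1 dmin sumd.
have N1 : 0 < N%:R - 1 :> R by rewrite subr_gt0 ltr1n.
have sumB : \sum_(j | j != j0) (d j - d j1) = (N%:R - 1) * (m - d j1).
  rewrite sumrB; move: sumd; rewrite (bigD1 j0) //= dj0 => /addrI ->.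
  rewrite sumr_const (_ : #|_| = N.-1); last by rewrite cardC1 card_ord.
  by rewrite -[d j1 *+ _]mulr_natl -subn1 natrB 1?ltnW // mulrBr.
split.
  by rewrite -subr_ge0 -(pmulr_rge0 _ N1) -sumB sumr_ge0 // => j _; rewrite subr_ge0.
move=> dm; move: sumB; rewrite dm subrr mulr0 => /eqP.
rewrite psumr_eq0 => [/allP d0 j jj0|j _]; last by rewrite -dm subr_ge0.
have /implyP/(_ jj0) := d0 j (mem_index_enum _).
by rewrite subr_eq0 => /eqP.
Qed.

(** * Eigenvalues of the Gram map and unitary designs *)

Section GramEquality.
Variables (R : rcfType) (F : field_kind) (n q : nat) (O : 'I_n -> samx R F q).
Hypotheses (n_gt0 : (0 < n)%N) (q_gt1 : (1 < q)%N).
Local Notation K := (scalars R F).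
Local Notation V := (samx R F q).

Let I : V := sa_of_mx 1%:M.
Let IE : I = 1%:M :> 'M[K]_q. Proof. by rewrite sa_of_mxK ?adjmx1. Qed.
Let trI_neq0 : \tr I != 0.
Proof. by rewrite IE mxtrace1 pnatr_eq0 -lt0n ltnW. Qed.
Let I_neq0 : I != 0.
Proof.
apply: contraNneq trI_neq0 => I0; rewrite IE; have := IE; rewrite I0 => <-.
by rewrite mx_of_sa0 linear0.
Qed.
Let gramI : gram O I = I.
Proof. by apply: mx_of_sa_inj; rewrite gramE IE gram_mx1. Qed.

Lemma gram_diagonalizable (e : (\dim {:V}).-tuple V) : basis_of {:V} e ->
  exists P d, P \in unitmx /\ mxof e e (gram O) = invmx P *m diag_mx d *m P.
Proof.
move=> eb; pose B (S T : V) := real_part (\tr ((S : 'M[K]_q) *m T)).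
apply: (@symmetric_diagonalizable R V (gram O) e B eb); rewrite /B.
- by move=> T; exact: real_mxtrace_scalar.
- by move=> S T; rewrite mxtrace_mulC.
- move=> S S_n0; apply: real_part_gt0.
  rewrite -[X in _ *m X]mx_of_saP; apply: mxtrace_adj_gt0.
  apply: contraNneq S_n0 => S0; apply/eqP/mx_of_sa_inj; rewrite S0.
  by rewrite mx_of_sa0.
by move=> S T; rewrite !gramE mxtrace_gram_mxC.
Qed.

(* A traceless eigenvector is killed by [gram O - alpha] for the design; any
   other eigenvector has eigenvalue 1, because the Gram map preserves traces. *)
Lemma unitary_design_eigenvalue alpha tau : unitary_design O alpha ->
  leigenvalue (gram O) tau -> tau != 1 -> tau = alpha.
Proof.
move=> des /leigenvalueP[S0]; pose S : V := S0; rewrite -/S => gS S_n0 tau1.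
have : \tr S = 0.
  have : \tr (gram O S : V) = \tr S by rewrite gramE mxtrace_gram_mx.
  rewrite gS mx_of_saZ linearZ /= => /eqP.
  rewrite -subr_eq0 -{2}[\tr S]mul1r -mulrBl mulf_eq0 subr_eq0.
  rewrite -(rmorph1 (of_real F)) (can_eq (@of_realK R F)) (negPf tau1) /=.
  by move=> /eqP.
move/des/eqP; rewrite gS -subr_eq0 -scalerBl scaler_eq0 (negPf S_n0) orbF subr_eq0.
by move=> /eqP.
Qed.

(* [gram O - alpha] then has rank at most one and its image contains I; since
   the Gram map preserves traces, it kills every traceless matrix. *)
Lemma diag_unitary_design (e : (\dim {:V}).-tuple V) P d j0 alpha :
  basis_of {:V} e -> P \in unitmx ->
  mxof e e (gram O) = invmx P *m diag_mx d *m P ->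
  alpha != 1 -> (forall j, j != j0 -> d 0 j = alpha) ->
  unitary_design O alpha.
Proof.
move=> eb Pu gP alpha1 dE.
pose w : V := vecof e (row j0 P).
have line S : exists c, gram O S - alpha *: S = c *: w.
  (* [u] holds the coordinates of [S] in the eigenbasis; subtracting [alpha] kills all of them
     except the one at [j0]. *)
  pose u := rVof e S *m invmx P; exists (u 0 j0 * (d 0 j0 - alpha)).
  apply: (can_inj (rVofK eb)); rewrite linearB !linearZ /= (rVof_app e eb) gP.
  rewrite vecofK ?(basis_free eb) // !mulmxA -/u.
  rewrite -{1}[rVof e S](mulmxKV Pu) -/u; clearbody u.
  rewrite scalerN scalemxAl -mulmxBl.
  rewrite rowE scalemxAl; congr (_ *m _); apply/rowP => j.
  rewrite mul_mx_diag !mxE eqxx /=.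
  have [->|jj0] := eqVneq j j0; first by rewrite mulr1 mulrBr [alpha * _]mulrC.
  by rewrite dE // mulr0 mulrC subrr.
have [c0 c0E] := line I; rewrite gramI in c0E.
(* For [I], [line] reads (1 - alpha) I = c0 w, and the left side is nonzero because [alpha] differs
   from 1. *)
have wI : w = ((1 - alpha) / c0) *: I.
  have c0_n0 : c0 != 0.
    apply: contraNneq alpha1 => c00; move/eqP: c0E; rewrite c00 scale0r -{1}[I]scale1r.
    by rewrite -scalerBl scaler_eq0 (negPf I_neq0) orbF subr_eq0 eq_sym.
  rewrite mulrC -scalerA scalerBl scale1r c0E scalerA mulVf ?scale1r //.
move=> S trS; have [c] := line S; rewrite wI scalerA; set b := c * _ => cE.
have b0 : b = 0.
  have : \tr (gram O S - alpha *: S : V) = 0.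
    rewrite mx_of_saB mx_of_saZ linearB linearZ /= gramE mxtrace_gram_mx //.
    by rewrite trS mulr0 subr0.
  rewrite cE mx_of_saZ linearZ /= => /eqP; rewrite mulf_eq0 (negPf trI_neq0) orbF.
  by rewrite fmorph_eq0 => /eqP.
by apply/eqP; rewrite -subr_eq0 cE b0 scale0r.
Qed.

Lemma gram_eigenvalue1 : leigenvalue (gram O) 1.
Proof. by apply/leigenvalueP; exists I; rewrite ?gramI ?scale1r. Qed.

End GramEquality.

(** * The constant [alphaQ] and the bound on the smallest eigenvalue *)

Lemma alphaQ_bounds (R : rcfType) F q : (1 < q)%N -> 0 < alphaQ R F q < 1.
Proof.
rewrite -(ltr1n R) => q_gt1; rewrite /alphaQ.
by case: F; rewrite invr_gt0 invf_lt1 ?andbT; lra.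
Qed.

(** The origin of [alphaQ]: the dimension minus one factors as (q - 1)(q / 2 + 1) over the reals and
    (q - 1)(q + 1) over the complex numbers. *)
Lemma dim_samx_alphaQ (R : rcfType) F q : (0 < q)%N ->
  ((\dim {:samx R F q})%:R - 1) * alphaQ R F q = q%:R - 1.
Proof.
rewrite -(ltr0n R) => q_gt0; rewrite dim_samx /alphaQ.
by case: F; field; rewrite lt0r_neq0 //; lra.
Qed.

Theorem proposition4p15 (R : realType) (F : field_kind) (n q : nat)
    (n_gt0 : (0 < n)%N) (q_ge2 : (2 <= q)%N) (O : 'I_n -> samx R F q)
    (O_ge2 : forall i, (2 <= size (spectrum (O i)))%N) :
  let qbar : R := n%:R^-1 * \sum_(i < n) (size (spectrum (O i)))%:R in
  let alpha : R := (qbar - 1) / (q%:R - 1) * alphaQ R F q in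
  lftrace (gram O) = qbar /\
  exists tau : R, [/\ is_smallest_eigenvalue (gram O) tau,
    tau <= alpha & tau = alpha <-> unitary_design O alpha].
Proof.
move=> qbar alpha; split; first exact: lftrace_gram.
set e := vbasis {:samx R F q}; have eb : basis_of {:samx R F q} e := vbasisP _.
have [P [d [Pu gP]]] := gram_diagonalizable O eb.
have ev a : leigenvalue (gram O) a <-> exists j, d 0 j = a.
  by rewrite (leigenvalue_mxof _ _ eb); exact: (eigenvalue_conj_diag _ Pu gP).
have [j0 dj0] : exists j, d 0 j = 1 by apply/ev; exact: gram_eigenvalue1.
have [j1 _ dmin] := @arg_minP _ _ _ j0 xpredT (d 0) isT.
have q1 : 0 < q%:R - 1 :> R by rewrite subr_gt0 ltr1n.
have /andP[alphaQ_gt0 alphaQ_lt1] := alphaQ_bounds R F q_ge2.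
have qbar_le : qbar <= q%:R.
  rewrite /qbar mulrC ler_pdivrMr ?ltr0n // -natr_sum -natrM ler_nat mulnC.
  rewrite -[X in (X * q)%N](card_ord n) -sum_nat_const; apply: leq_sum => i _.
  exact: size_spectrum.
have alpha1 : alpha < 1.
  apply: le_lt_trans alphaQ_lt1; rewrite /alpha ler_piMl ?(ltW alphaQ_gt0) //.
  by rewrite ler_pdivrMr // mul1r lerB.
(* Thus [alpha] is the mean of the eigenvalues left after removing one eigenvalue 1. *)
have dim_alpha : ((\dim {:samx R F q})%:R - 1) * alpha = qbar - 1.
  by rewrite /alpha mulrCA dim_samx_alphaQ ?(ltnW q_ge2) // divfK // lt0r_neq0.
have dim_gt1 : (1 < \dim {:samx R F q})%N.
  rewrite -(ltr1n R) -subr_gt0 -(pmulr_lgt0 _ alphaQ_gt0).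
  by rewrite dim_samx_alphaQ // ltnW.
(* The trace is invariant under conjugation, so the diagonal entries sum to [qbar]. *)
have sumd : \sum_j d 0 j = 1 + ((\dim {:samx R F q})%:R - 1) * alpha.
  rewrite dim_alpha addrC subrK -/qbar -[qbar](lftrace_gram O) /lftrace gP.
  by rewrite mxtrace_mulC mulmxA mulmxV // mul1mx mxtrace_diag.
have [tau_le tau_eq] := min_le_mean dim_gt1 dj0 alpha1 (fun j => dmin j isT) sumd.
have tau_ev : leigenvalue (gram O) (d 0 j1) by apply/ev; exists j1.
exists (d 0 j1); split=> //.
  by split=> // b /ev[j <-]; exact: dmin.
split=> [/tau_eq dE|des].
  by apply: (diag_unitary_design n_gt0 q_ge2 eb Pu gP _ dE); rewrite lt_eqF.
apply: (unitary_design_eigenvalue n_gt0 des tau_ev).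
(* The chain tau <= alpha < 1 rules out the eigenvalue 1 of the identity. *)
by rewrite lt_eqF // (le_lt_trans tau_le).
Qed.
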